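(* Let $\mathcal{P}=\{P_\theta:\theta\in\Theta\}$ be a family of probability measures on a sample space $\mathcal{X}$, all dominated by a common measure $\mu$, and let $w$ be a probability measure on $\Theta$. For every $\alpha>1$, with $f_\alpha(x)=x^\alpha-1$, $$I_{f_\alpha}(w,\mathcal{P})\le\inf_{\epsilon>0}\,(1+\epsilon^2)\,M_\alpha(\epsilon,\Theta)^{\alpha-1}-1.$$
   Context: All functions and sets are assumed measurable as needed. For $\alpha>1$ and probability measures $P,Q$ with densities $p,q$ with respect to a common measure, $D_{f_\alpha}(P\|Q)=\int_{\{q>0\}}p^\alpha q^{1-\alpha}\,\mathrm{d}\mu-1$ if $P$ is absolutely continuous with respect to $Q$, and $+\infty$ otherwise. The $f_\alpha$-informativity is $I_{f_\alpha}(w,\mathcal{P}):=\inf_Q\int_\Theta D_{f_\alpha}(P_\theta\|Q)\,w(\mathrm{d}\theta)$, the infimum being over all probability measures $Q$ on $\mathcal{X}$. For $\epsilon>0$, $M_\alpha(\epsilon,\Theta)$ denotes any upper bound (possibly $+\infty$) on the smallest number $M$ for which there exist probability measures $Q_1,\dots,Q_M$ on $\mathcal{X}$ with $\sup_{\theta\in\Theta}\min_{1\le j\le M}D_{f_\alpha}(P_\theta\|Q_j)\le\epsilon^2$. *)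

(* Defs.v *)
From HB Require Import structures.
From mathcomp Require Import all_boot all_order all_algebra.
From mathcomp Require Import all_classical all_reals all_analysis.
From mathcomp Require Import measurable_realfun.
Set Implicit Arguments.
Unset Strict Implicit.
Unset Printing Implicit Defensive.
Import Order.TTheory GRing.Theory Num.Theory.
Import numFieldNormedType.Exports.
Local Open Scope classical_set_scope.
Local Open Scope ring_scope.
Local Open Scope ereal_scope.

Section psum.
Context d (X : measurableType d) (R : realType) (P Q : probability X R).

(* The finite measure P + Q dominates both P and Q. *)
Definition psum : set X -> \bar R := measure_add P Q.

HB.instance Definition _ := Measure.on psum.

Lemma psumE A : psum A = P A + Q A.
Proof. exact: measure_addE. Qed.

Let psum_fin : fin_num_fun psum.
Proof. by move=> A mA; rewrite psumE fin_numD !fin_num_measure. Qed.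

HB.instance Definition _ := Measure_isFinite.Build _ _ _ psum psum_fin.

Lemma dominates_psuml : P `<< psum.
Proof.
apply/null_content_dominatesP => A mA /eqP; rewrite /= psumE.
by rewrite padde_eq0 ?measure_ge0// => /andP[/eqP].
Qed.

Lemma dominates_psumr : Q `<< psum.
Proof.
apply/null_content_dominatesP => A mA /eqP; rewrite /= psumE.
by rewrite padde_eq0 ?measure_ge0// => /andP[_ /eqP].
Qed.

End psum.

Section falpha_div.
Context d (X : measurableType d) (R : realType).
Implicit Types (alpha : R) (P Q : probability X R) (p q : X -> R).

Definition is_density (nu : {measure set X -> \bar R}) P p :=
  [/\ measurable_fun setT p, (forall x, 0 <= p x)%R &
      forall A, measurable A -> P A = \int[nu]_(x in A) (p x)%:E].

Definition falpha_int (nu : {measure set X -> \bar R}) alpha p q : \bar R :=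
  \int[nu]_(x in [set x | 0 < q x]%R)
    (powR (p x) alpha * powR (q x) (1 - alpha))%:E.

(* The value does not depend on the dominating measure nor on the versions of
   the densities, see [falpha_divE]; P + Q is a choice that is always
   available. *)
Definition falpha_div alpha P Q : \bar R :=
  if `[< P `<< Q >] then
    falpha_int (psum P Q) alpha
      (fine \o Radon_Nikodym (charge_of_finite_measure P) (psum P Q))
      (fine \o Radon_Nikodym (charge_of_finite_measure Q) (psum P Q)) - 1
  else +oo.

Let h alpha (a b : R) : R :=
  if (0 < b)%R then (powR a alpha * powR b (1 - alpha))%R else 0%R.

Let h_ge0 alpha a b : (0 <= h alpha a b)%R.
Proof. by rewrite /h; case: ifP => // _; rewrite mulr_ge0 ?powR_ge0. Qed.

Let measurable_h alpha p q : measurable_fun setT p -> measurable_fun setT q ->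
  measurable_fun setT (fun x => h alpha (p x) (q x)).
Proof.
move=> mp mq; apply: measurable_fun_ifT => //.
  by apply: measurable_fun_ltr.
by apply: measurable_funM; apply: (measurableT_comp (measurable_powR _)).
Qed.

Let falpha_inth nu alpha p q :
  falpha_int nu alpha p q = \int[nu]_x (h alpha (p x) (q x))%:E.
Proof.
rewrite /falpha_int integral_mkcond; apply: eq_integral => x _.
rewrite patchE /h; case: ifPn => [|]; first by rewrite inE/= => ->.
by rewrite notin_setE/= => /negP/negbTE ->.
Qed.

Let hM alpha (a b r : R) : (0 <= a)%R -> (0 <= b)%R -> (0 <= r)%R ->
  (h alpha a b * r = h alpha (a * r) (b * r))%R.
Proof.
move=> a0 b0; rewrite le_eqVlt => /predU1P[<-|r0].
  by rewrite /h !mulr0 ltxx.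
rewrite /h pmulr_lgt0//; case: ifP => _; last by rewrite mul0r.
have rE : r = (powR r alpha * powR r (1 - alpha))%R.
  by rewrite -powRD ?subrKC ?powRr1 ?ltW// gt_eqF// implybT.
by rewrite !powRM ?(ltW r0)// mulrACA -rE.
Qed.

Let f_density (P : probability X R)
    (nu : {sigma_finite_measure set X -> \bar R}) p :
  is_density nu P p -> P `<< nu /\
  ae_eq nu setT (Radon_Nikodym_SigmaFinite.f P nu) (EFin \o p).
Proof.
move=> [mp p0 Pp].
have Pnu : P `<< nu.
  apply/null_content_dominatesP => A mA A0; rewrite Pp//.
  by apply: null_set_integral => //; exact/measurable_EFinP/measurable_funTS.
split => //; apply: integral_ae_eq => //.
- exact: Radon_Nikodym_SigmaFinite.f_integrable.
- exact/measurable_EFinP.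
- move=> E _ mE; apply: etrans (Pp E mE).
  exact/esym/Radon_Nikodym_SigmaFinite.f_integral.
Qed.

Lemma falpha_divE (nu : {sigma_finite_measure set X -> \bar R})
    alpha P Q p q :
  is_density nu P p -> is_density nu Q q -> P `<< Q ->
  falpha_div alpha P Q = falpha_int nu alpha p q - 1.
Proof.
move=> dp dq PQ; rewrite /falpha_div asboolT//; congr (_ - _).
have [Pnu fp] := f_density dp; have [Qnu fq] := f_density dq.
case: dp dq => mp p0 _ [mq q0 _].
pose m : {finite_measure set X -> \bar R} := psum P Q.
have Pm : P `<< m := @dominates_psuml _ _ _ P Q.
have Qm : Q `<< m := @dominates_psumr _ _ _ P Q.
have mnu : m `<< nu.
  move: Pnu Qnu => /null_content_dominatesP Pnu /null_content_dominatesP Qnu.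
  apply/null_content_dominatesP => A mA A0; rewrite /m/= psumE.
  by rewrite Pnu// Qnu// adde0.
pose F (P' : {finite_measure set X -> \bar R})
  (nu' : {sigma_finite_measure set X -> \bar R}) x : R :=
  fine (Radon_Nikodym_SigmaFinite.f P' nu' x).
have FE (P' : {finite_measure set X -> \bar R})
    (nu' : {sigma_finite_measure set X -> \bar R}) : P' `<< nu' ->
  forall x, (F P' nu' x)%:E = Radon_Nikodym_SigmaFinite.f P' nu' x.
  by move=> ? x; rewrite fineK// Radon_Nikodym_SigmaFinite.f_fin_num.
have F0 (P' : {finite_measure set X -> \bar R})
    (nu' : {sigma_finite_measure set X -> \bar R}) : P' `<< nu' ->
  forall x, (0 <= F P' nu' x)%R.
  by move=> ? x; rewrite fine_ge0// Radon_Nikodym_SigmaFinite.f_ge0.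
have mF (P' : {finite_measure set X -> \bar R})
    (nu' : {sigma_finite_measure set X -> \bar R}) : P' `<< nu' ->
  measurable_fun setT (F P' nu').
  move=> ?; apply: measurableT_comp => //.
  by apply: measurable_int; exact: Radon_Nikodym_SigmaFinite.f_integrable.
have mRN (P' : {finite_measure set X -> \bar R}) : P' `<< m ->
  measurable_fun setT (fine \o Radon_Nikodym (charge_of_finite_measure P') m).
  move=> ?; apply: measurableT_comp => //.
rewrite !falpha_inth.
transitivity (\int[m]_x (h alpha (F P m x) (F Q m x))%:E).
  apply: ge0_ae_eq_integral => //.
  - by apply/measurable_EFinP; apply: measurable_h; exact: mRN.
  - by apply/measurable_EFinP; apply: measurable_h; exact: mF.
  - by move=> x _; rewrite lee_fin.
  - by move=> x _; rewrite lee_fin.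
  - have := ae_eq_Radon_Nikodym_SigmaFinite Pm measurableT.
    have := ae_eq_Radon_Nikodym_SigmaFinite Qm measurableT.
    apply: filterS2 => x /(_ I) qE /(_ I) pE _ /=.
    by rewrite /F pE qE.
rewrite -(Radon_Nikodym_SigmaFinite.change_of_variables mnu)//; last 2 first.
- by move=> x; rewrite lee_fin.
- by apply/measurable_EFinP; apply: measurable_h; exact: mF.
apply: ge0_ae_eq_integral => //.
- apply: emeasurable_funM; last first.
    by apply: measurable_int; exact: Radon_Nikodym_SigmaFinite.f_integrable.
  by apply/measurable_EFinP; apply: measurable_h; exact: mF.
- by apply/measurable_EFinP; exact: measurable_h.
- by move=> x _; rewrite -FE// -EFinM lee_fin mulr_ge0// F0.
- by move=> x _; rewrite lee_fin.
- have cP := Radon_Nikodym_SigmaFinite.chain_rule Pm mnu measurableT.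
  have cQ := Radon_Nikodym_SigmaFinite.chain_rule Qm mnu measurableT.
  have pE : ae_eq nu setT (fun x => (F P m x * F m nu x)%:E) (EFin \o p).
    move: cP fp; apply: filterS2 => x /(_ I) cx /(_ I) fx _.
    by rewrite EFinM !FE// -fx cx.
  have qE : ae_eq nu setT (fun x => (F Q m x * F m nu x)%:E) (EFin \o q).
    move: cQ fq; apply: filterS2 => x /(_ I) cx /(_ I) fx _.
    by rewrite EFinM !FE// -fx cx.
  move: pE qE; apply: filterS2 => x /(_ I) /= [px] /(_ I) /= [qx] _.
  by rewrite -FE// -EFinM hM ?F0// px qx.
Qed.

End falpha_div.

Section informativity.
Context dX dT (X : measurableType dX) (Theta : measurableType dT)
        (R : realType).
Implicit Types (alpha eps : R) (P : Theta -> probability X R).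

Definition informativity alpha (w : probability Theta R) P : \bar R :=
  ereal_inf [set \int[w]_theta falpha_div alpha (P theta) Q
            | Q in [set: probability X R]].

Definition covered_by alpha P eps (m : nat) : Prop :=
  exists Q : 'I_m -> probability X R,
    ereal_sup [set \big[Order.min/+oo]_(j < m) falpha_div alpha (P theta) (Q j)
              | theta in [set: Theta]] <= (eps ^+ 2)%:E.

(* The smallest m such that [covered_by alpha P eps m], and +oo if there is
   none. *)
Definition covering_number alpha P eps : \bar R :=
  ereal_inf [set m%:R%:E | m in [set m : nat | covered_by alpha P eps m]].

End informativity.

(* Main.v *)
Require Import Defs.
From HB Require Import structures.
From mathcomp Require Import all_boot all_order all_algebra.
From mathcomp Require Import all_classical all_reals all_analysis.
From mathcomp Require Import measurable_realfun.
Import Order.TTheory GRing.Theory Num.Theory.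
Import numFieldNormedType.Exports.
Local Open Scope classical_set_scope.
Local Open Scope ring_scope.
Local Open Scope ereal_scope.

(** The idea is to bound the infimum defining the informativity by the value
    at the uniform mixture of a covering.  If [Q_1, ..., Q_m] cover the family
    at scale [eps] and [Q] is their average, then every [Q_j] is at most [m Q]
    as a measure.  Dominating [Q_j] by a multiple of [Q] costs only a factor
    [m ^ (alpha - 1)]: relative to [Q], the measure [Q_j] has a density
    [q <= m], so [1 <= m ^ (alpha - 1) * q ^ (1 - alpha)] wherever [q > 0],
    and [P_theta], being absolutely continuous with respect to [Q_j], puts no
    mass where [q = 0]; hence
      [1 + D(P_theta || Q) = \int p ^ alpha dQ
        <= m ^ (alpha - 1) * \int_(q > 0) p ^ alpha q ^ (1 - alpha) dQ
         = m ^ (alpha - 1) * (1 + D(P_theta || Q_j))],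
    which is [falpha_div_scale].  Choosing for each [theta] a [Q_j] with
    [D(P_theta || Q_j) <= eps ^ 2] gives a bound on [D(P_theta || Q)] that is
    uniform in [theta], so integrating it against [w] preserves it
    ([covered_by_informativity]).

    It remains to pass from coverings to [M eps].  A finite covering number is
    attained, being an infimum of naturals, and [x ^ (alpha - 1)] is
    nondecreasing; when [M eps] is infinite the right-hand side is infinite,
    since [alpha - 1 > 0]. *)

Lemma dominates_density {d} {X : measurableType d} {R : realType}
    {nu P : probability X R} :
  P `<< nu -> exists p : X -> R, is_density nu P p.
Proof.
move=> Pnu; exists (fine \o Radon_Nikodym_SigmaFinite.f P nu); split.
- apply: measurableT_comp => //; apply: measurable_int.
  exact: Radon_Nikodym_SigmaFinite.f_integrable.
- by move=> x; rewrite fine_ge0// Radon_Nikodym_SigmaFinite.f_ge0.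
- move=> A mA; rewrite (Radon_Nikodym_SigmaFinite.f_integral Pnu)//.
  apply: eq_integral => x _.
  by rewrite /= fineK// Radon_Nikodym_SigmaFinite.f_fin_num.
Qed.

Lemma is_density_cst1 {d} {X : measurableType d} {R : realType}
    (Q : probability X R) : is_density Q Q (cst 1%R).
Proof.
split => [|x|A mA]; [exact: measurable_cst|by []|].
by rewrite -[LHS]mul1e -(integral_cst _ mA).
Qed.

(** On the set where [q] exceeds [c], the nonnegative function [q - c] has a
    nonpositive integral, so it vanishes almost everywhere there; as it is
    positive on that set, the set is negligible. *)
Lemma density_le {d} {X : measurableType d} {R : realType}
    {nu Q : probability X R} {q : X -> R} {c : R} :
  (0 <= c)%R -> is_density nu Q q ->
  (forall A, measurable A -> Q A <= c%:E * nu A) ->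
  {ae nu, forall x, (q x <= c)%R}.
Proof.
move=> c0 [mq q0 Qq] Qc.
pose A := [set x | (c < q x)%R].
have mA : measurable A.
  rewrite -[A]setTI; apply: (measurable_fun_ltr (f := cst c)) => //.
have mg : measurable_fun A (fun x => (q x - c)%:E).
  by apply/measurable_EFinP/measurable_funTS; apply: measurable_funB.
have g0 x : A x -> 0 <= (q x - c)%:E.
  by rewrite lee_fin subr_ge0 => /ltW.
have ig : \int[nu]_(x in A) (q x - c)%:E = 0.
  apply/eqP; rewrite eq_le integral_ge0// andbT.
  have := Qc _ mA; rewrite Qq//.
  rewrite (eq_integral (fun x => (cst c%:E x + (q x - c)%:E))); last first.
    by move=> x _; rewrite /= -EFinD subrKC.
  rewrite ge0_integralD//.
  rewrite integral_cst// -leeBrDl; last first.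
    by rewrite fin_numM// fin_num_measure.
  by rewrite subee// fin_numM// fin_num_measure.
have : ae_eq nu A (fun x => (q x - c)%:E) (cst 0).
  apply/ae_eq_integral_abs => //; rewrite -[RHS]ig.
  by apply: eq_integral => x /[!inE] Ax; rewrite gee0_abs ?g0.
apply: filterS => x /= h; rewrite leNgt; apply/negP => cq.
by have [/eqP] := h cq; rewrite subr_eq0 gt_eqF.
Qed.

(** The densities are taken with respect to [Q] itself: that of [Q] is then
    the constant 1, and the hypothesis becomes a pointwise bound on the density
    of [Q']. *)
Lemma falpha_div_scale {d} {X : measurableType d} {R : realType}
    {P Q Q' : probability X R} {alpha c : R} :
  (1 < alpha)%R -> (0 <= c)%R -> P `<< Q' ->
  (forall A, measurable A -> Q' A <= c%:E * Q A) ->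
  falpha_div alpha P Q + 1 <=
    (powR c (alpha - 1))%:E * (falpha_div alpha P Q' + 1).
Proof.
move=> alpha1 c0 PQ' Q'c.
have Q'Q : Q' `<< Q.
  apply/null_content_dominatesP => A mA A0; apply/eqP.
  by rewrite eq_le measure_ge0 andbT; have := Q'c A mA; rewrite A0 mule0.
have PQ : P `<< Q by exact: null_dominates_trans PQ' Q'Q.
have [p dp] := dominates_density PQ.
have [q dq] := dominates_density Q'Q.
rewrite (falpha_divE alpha dp (is_density_cst1 Q) PQ).
rewrite (falpha_divE alpha dp dq PQ') !subeK//.
have q_le := density_le c0 dq Q'c.
case: dp dq => mp p0 Pp [mq q0 Qq].
pose D := [set x | (0 < q x)%R].
have mD : measurable D.
  by rewrite -[D]setTI; apply: (measurable_fun_ltr (f := cst 0%R)).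
have mpa : measurable_fun setT (fun x => powR (p x) alpha).
  by apply: (measurableT_comp (measurable_powR _)).
have mqa : measurable_fun setT (fun x => powR (q x) (1 - alpha)).
  by apply: (measurableT_comp (measurable_powR _)).
(* P charges no set that Q' does not charge, and Q' has density 0 off D. *)
have p_eq0 : ae_eq Q (~` D) (EFin \o p) (cst 0).
  apply/ae_eq_integral_abs; [exact: measurableC| |].
    exact/measurable_EFinP/measurable_funTS.
  have -> : \int[Q]_(x in ~` D) `|(EFin \o p) x| = P (~` D).
    rewrite Pp; last exact: measurableC.
    by apply: eq_integral => x _; rewrite /= ger0_norm.
  move/null_content_dominatesP : PQ'; apply; first exact: measurableC.
  apply: etrans (Qq _ (measurableC mD)) _.
  rewrite integral0_eq// => x /negP; rewrite -leNgt => qx.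
  by congr EFin; apply/eqP; rewrite eq_le qx q0.
rewrite /falpha_int -ge0_integralZl_EFin ?powR_ge0//; last 2 first.
- by move=> x _; rewrite lee_fin mulr_ge0 ?powR_ge0.
- by apply/measurable_EFinP/measurable_funTS; exact: measurable_funM.
have -> : [set x | (0 < cst (1 : R) x)%R] = [set: X].
  by apply/seteqP; split => x //= _; exact: ltr01.
rewrite [leRHS]integral_mkcond.
apply: ae_ge0_le_integral => //.
- by move=> x _; rewrite lee_fin mulr_ge0 ?powR_ge0.
- apply/measurable_EFinP; apply: measurable_funM => //=; exact: measurable_cst.
- move=> x _; apply: erestrict_ge0 => y _.
  by rewrite -EFinM lee_fin !mulr_ge0 ?powR_ge0.
- apply/(measurable_restrictT _ mD).
  apply/measurable_EFinP/measurable_funTS; apply: measurable_funM => //.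
  exact: measurable_funM.
move: q_le p_eq0; apply: filterS2 => x qc px _.
rewrite patchE /= powR1 mulr1; case: ifPn => [|]; rewrite ?inE ?notin_setE => /= Dx.
  rewrite lee_fin mulrCA ler_peMr ?powR_ge0//.
  have q1 : (powR (q x) (alpha - 1) * powR (q x) (1 - alpha) = 1)%R.
    rewrite -powRD; first by rewrite addrA subrK subrr powRr0.
    by rewrite (gt_eqF Dx) implybT.
  rewrite -[leLHS]q1 ler_wpM2r ?powR_ge0// ge0_ler_powR ?nnegrE//.
  by rewrite subr_ge0 ltW.
by have [->] := px Dx; rewrite powR0// gt_eqF// (lt_trans ltr01).
Qed.

Section uniform_mixture.
Context {d} {X : measurableType d} {R : realType} {m : nat}.
Variable Q : 'I_m.+1 -> probability X R.

Definition uniform_mixture : set X -> \bar R :=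
  mscale (m.+1%:R^-1)%:nng%R (msum (fun k => Q (inord k)) m.+1).

HB.instance Definition _ := Measure.on uniform_mixture.

Lemma uniform_mixtureE A :
  uniform_mixture A = (m.+1%:R^-1)%R%:E * \sum_(j < m.+1) Q j A.
Proof.
rewrite /uniform_mixture /mscale /msum; congr (_ * _).
by apply: eq_bigr => j _; rewrite inord_val.
Qed.

Let uniform_mixtureT : uniform_mixture setT = 1.
Proof.
rewrite uniform_mixtureE.
under eq_bigr do rewrite probability_setT.
by rewrite sumEFin sumr_const card_ord -EFinM mulVf.
Qed.

HB.instance Definition _ :=
  Measure_isProbability.Build _ _ _ uniform_mixture uniform_mixtureT.

(** The factor [m.+1] is what makes the size of the covering appear in the
    bound, through [falpha_div_scale]. *)
Lemma le_uniform_mixture j A :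
  measurable A -> Q j A <= m.+1%:R%:E * uniform_mixture A.
Proof.
move=> mA; rewrite uniform_mixtureE muleA -EFinM divff// mul1e.
rewrite (bigD1 j)//= leeDl//.
by apply: sume_ge0.
Qed.

End uniform_mixture.

(** A lower bound makes a divergence that is bounded above a bounded function
    of [theta], hence an integrable one; -1 comes from dropping the nonnegative
    integral. *)
Lemma falpha_div_geN1 {d} {X : measurableType d} {R : realType}
    (alpha : R) (P Q : probability X R) : - 1 <= falpha_div alpha P Q.
Proof.
rewrite /falpha_div; case: ifP => _; last exact: leey.
rewrite -[leLHS]add0e leeD2r// integral_ge0// => x _.
by rewrite lee_fin mulr_ge0 ?powR_ge0.
Qed.

(** A divergence bounded uniformly in [theta] is integrable with respect to
    [w], and its average obeys the same bound since [w] has mass 1. *)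
Lemma informativity_le {dX dT} {X : measurableType dX}
    {Theta : measurableType dT} {R : realType} {alpha C : R}
    {P : Theta -> probability X R}
    (w : probability Theta R) (Q : probability X R) :
  measurable_fun [set: Theta] (fun theta => falpha_div alpha (P theta) Q) ->
  (forall theta, falpha_div alpha (P theta) Q <= C%:E) ->
  informativity alpha w P <= C%:E.
Proof.
move=> mD DC; apply: ge_ereal_inf.
exists (\int[w]_theta falpha_div alpha (P theta) Q); first by exists Q.
have DE theta : ((fine (falpha_div alpha (P theta) Q))%:E =
    falpha_div alpha (P theta) Q).
  rewrite fineK// fin_numElt (lt_le_trans _ (falpha_div_geN1 _ _ _)) ?ltNyr//.
  by rewrite (le_lt_trans (DC theta)) ?ltry.
have intC : w.-integrable setT (cst C%:E).
  by apply: finite_measure_integrable_cst.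
rewrite -[leRHS]mule1 -(@probability_setT _ _ _ w) -integral_cst//.
apply: le_integral => //.
(* The divergence lies in [- 1, C], hence in [- max 1 |C|, max 1 |C|]. *)
apply: (@le_integrable _ _ _ w _ _ _ (cst (Num.max 1 `|C|)%:E)) => //.
  move=> theta _; rewrite -DE /= lee_fin ler_norml.
  rewrite [(`|Num.max _ _|)%R]ger0_norm; last by rewrite le_max ler01.
  have := falpha_div_geN1 alpha (P theta) Q; have := DC theta.
  rewrite -DE !lee_fin => h1 h2; apply/andP; split.
    by apply: le_trans h2; rewrite lerN2 le_max lexx.
  by rewrite le_max (le_trans h1 (ler_norm C)) orbT.
by apply: finite_measure_integrable_cst.
Qed.

Lemma covered_by_informativity {dX dT} {X : measurableType dX}
    {Theta : measurableType dT} {R : realType} {alpha eps : R} {m : nat}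
    {P : Theta -> probability X R} (w : probability Theta R) :
  (1 < alpha)%R ->
  (forall Q : probability X R,
    measurable_fun [set: Theta] (fun theta => falpha_div alpha (P theta) Q)) ->
  Defs.covered_by alpha P eps m.+1 ->
  informativity alpha w P + 1 <=
    ((1 + eps ^+ 2) * powR m.+1%:R (alpha - 1))%:E.
Proof.
move=> alpha1 mD [Q Qeps]; rewrite -leeBrDr// -EFinB.
apply: (informativity_le w (uniform_mixture Q)) => // theta.
pose F j := falpha_div alpha (P theta) (Q j).
have [j Fj] : exists j, F j <= (eps ^+ 2)%:E.
  have : \big[Order.min/+oo]_(j < m.+1) F j <= (eps ^+ 2)%:E.
    by apply: le_trans Qeps; apply: ereal_sup_ubound; exists theta.
  rewrite (bigmin_eq_arg _ ord0)//; last by move=> i _; exact: leey.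
  by move=> ?; eexists; eassumption.
have PQj : P theta `<< Q j.
  move: Fj; rewrite /F /falpha_div; case: ifP => [/asboolP//|_].
  by rewrite leye_eq.
rewrite EFinB leeBrDr//.
apply: le_trans (falpha_div_scale alpha1 _ PQj (le_uniform_mixture Q j)) _ => //.
rewrite mulrC EFinM lee_wpmul2l ?lee_fin ?powR_ge0//.
rewrite EFinD addeC. exact: leeD2r.
Qed.

Lemma covering_number_attained {dX dT} {X : measurableType dX}
    {Theta : measurableType dT} {R : realType} {alpha eps r : R}
    {P : Theta -> probability X R} :
  covering_number alpha P eps <= r%:E ->
  exists2 m, Defs.covered_by alpha P eps m & (m%:R <= r)%R.
Proof.
move=> Nr.
have [m0 cm0] : exists m, Defs.covered_by alpha P eps m.
  apply: contrapT => /forallNP no; move: Nr; rewrite /covering_number.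
  rewrite (_ : [set _ | _ in _] = set0) ?ereal_inf0 ?leye_eq//.
  by apply/seteqP; split => // x [m /= /no].
have ex : exists m, `[< Defs.covered_by alpha P eps m >] by exists m0; exact/asboolP.
case: (ex_minnP ex) => m /asboolP cm min_m; exists m => //.
rewrite -lee_fin; apply: le_trans Nr; apply: le_ereal_inf_tmp => _ [k ck <-].
by rewrite lee_fin ler_nat min_m//; exact/asboolP.
Qed.

(** The minimum over an empty covering is [+oo], and [Theta] has a point at
    which this is felt because it carries the probability [w]. *)
Lemma covered_by_gt0 {dX dT} {X : measurableType dX}
    {Theta : measurableType dT} {R : realType} {alpha eps : R} {m : nat}
    {P : Theta -> probability X R} (w : probability Theta R) :
  Defs.covered_by alpha P eps m -> (0 < m)%N.
Proof.
case: m => // -[Q Qeps].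
have [theta _] : [set: Theta] !=set0.
  apply/set0P/eqP => T0; have := @probability_setT _ _ _ w.
  by rewrite T0 measure0 => /eqP; rewrite eq_sym onee_eq0.
suff : +oo <= (eps ^+ 2)%:E by rewrite leye_eq.
apply: le_trans Qeps; apply: ereal_sup_ubound.
by exists theta => //; rewrite big_ord0.
Qed.

Theorem corollary5p3 (R : realType) (dX dT : measure_display)
  (X : measurableType dX) (Theta : measurableType dT)
  (mu : {measure set X -> \bar R}) (P : Theta -> probability X R)
  (w : probability Theta R) (alpha : R) (M : R -> \bar R)
  (P_mu : forall theta : Theta, P theta `<< mu)
  (alpha_gt1 : (1 < alpha)%R)
  (mD : forall Q : probability X R,
    measurable_fun [set: Theta] (fun theta => falpha_div alpha (P theta) Q))
  (M_ub : forall eps : R, (0 < eps)%R -> covering_number alpha P eps <= M eps) :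
  informativity alpha w P <=
    ereal_inf [set (1 + eps ^+ 2)%:E * poweR (M eps) (alpha - 1)
              | eps in [set eps : R | (0 < eps)%R]] - 1.
Proof.
rewrite leeBrDr//; apply: le_ereal_inf_tmp => _ [eps /= eps0 <-].
have := M_ub _ eps0; case: (M eps) => [r| |] /=.
- move=> /covering_number_attained[[|m] cm mr].
    by have := covered_by_gt0 w cm.
  apply: le_trans (covered_by_informativity w alpha_gt1 mD cm) _.
  rewrite -EFinM lee_fin ler_wpM2l ?addr_ge0 ?sqr_ge0//.
  have r0 : (0 <= r)%R by apply: le_trans mr; exact: ler0n.
  by rewrite ge0_ler_powR ?nnegrE// subr_ge0 ltW.
- by rewrite gt_eqF ?subr_gt0// gt0_muley ?leey// lte_fin ltr_pwDl ?sqr_ge0.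
- rewrite leeNy_eq => /eqP N_Ny.
  suff : 0 <= covering_number alpha P eps by rewrite N_Ny.
  by apply: le_ereal_inf_tmp => _ [k _ <-]; rewrite lee_fin.
Qed.
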